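(* Let $w_k\ge0$ for $k=0,\dots,K$. Assume that there are constants $C^{\mathrm{can}+,\mathrm{up}}_{k,N,H}<\infty$, $c^{\mathrm{can}+}_{k,N,H}>0$ ($0\le k\le K$) and $\delta^{\mathrm{can}+}_*>0$ such that for all $k=0,\dots,K$: (i) $M^{\mathrm{can}+}_{k,N,H}(D_k)\le C^{\mathrm{can}+,\mathrm{up}}_{k,N,H}\,(L_k^{\mathrm{AEF}}+P_k^{\mathrm{tail},+}+R_k^{\mathrm{PFE},+})$; (ii) $M^{\mathrm{can}+}_{k,N,H}(D_k)\ge c^{\mathrm{can}+}_{k,N,H}\,\delta^{\mathrm{can}+}_k$; (iii) $\Phi_k(\rho)\ge\varepsilon_{\mathrm{CKN}}$ implies $\delta^{\mathrm{can}+}_k\ge\delta^{\mathrm{can}+}_*$. With $\mathcal B_{\mathrm{can}}:=\{0\le k\le K:\Phi_k(\rho)\ge\varepsilon_{\mathrm{CKN}}\}$, one has $$\sum_{k\in\mathcal B_{\mathrm{can}}}w_k\le C_{\mathrm{can}+,K}\sum_{k=0}^K w_k\,(L_k^{\mathrm{AEF}}+P_k^{\mathrm{tail},+}+R_k^{\mathrm{PFE},+}),$$ where one may take $$C_{\mathrm{can}+,K}=\frac{\max_{0\le k\le K}C^{\mathrm{can}+,\mathrm{up}}_{k,N,H}}{\big(\min_{0\le k\le K}c^{\mathrm{can}+}_{k,N,H}\big)\,\delta^{\mathrm{can}+}_*}.$$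
   Context: $(u,p)$ is a suitable weak solution (Caffarelli–Kohn–Nirenberg sense) of the 3D incompressible Navier–Stokes equations on $Q_{r_0}(z_0)=B_{r_0}(x_0)\times(t_0-r_0^2,t_0)$. $B_\rho$ is the ball of radius $\rho$ about $0$, $Q_\rho=B_\rho\times(-\rho^2,0)$, $(f)_{B_\rho}(s)$ the spatial mean over $B_\rho$. Fix $0<\rho\le\lambda<3/4$, $r_k=\lambda^kr_0$, $k=0,\dots,K$, and normalized fields on $Q_1$: $u_k(y,s)=r_ku(x_0+r_ky,t_0+r_k^2s)$, $p_k(y,s)=r_k^2p(x_0+r_ky,t_0+r_k^2s)$. $\Phi_k(\rho):=\rho^{-2}\int_{Q_\rho}|u_k|^3+\rho^{-2}\int_{-\rho^2}^0\int_{B_\rho}|p_k-(p_k)_{B_\rho}(s)|^{3/2}$; $\varepsilon_{\mathrm{CKN}}>0$ is the fixed threshold of the CKN epsilon-regularity theorem. Cutoffs: $\eta,\chi\in C_c^\infty(B_1)$, $\eta=\chi=1$ on $B_{3/4}$, $A_\chi:=\operatorname{supp}\nabla\chi\cup\operatorname{supp}\Delta\chi$. Pressure parts ($R_i$ Riesz transforms in space, applied after zero extension, repeated indices summed): $P^{\mathrm{act}}_k:=R_iR_j(\eta u_{k,i}u_{k,j})$, $P^{\mathrm{harm}}_k:=p_k-P^{\mathrm{act}}_k$, $P^{\mathrm{act},0}_k:=P^{\mathrm{act}}_k-(P^{\mathrm{act}}_k)_{B_\rho}(s)$, $P^{\mathrm{harm},0}_k:=P^{\mathrm{harm}}_k-(P^{\mathrm{harm}}_k)_{B_\rho}(s)$.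 $\Pi^{\mathrm{prs}}_{N,k},\Pi^{\mathrm{harm}}_{H,k}$ are bounded finite-rank projections on $L^{3/2}(Q_\rho)$, with rank parameters $N,H$. Pressure costs (norms in $L^{3/2}(Q_\rho)$): $P_k^{\mathrm{comm}}:=\|[\eta,R_iR_j](u_{k,i}u_{k,j})\|^{3/2}$, $P_k^{\mathrm{trunc}}:=\|(I-\Pi^{\mathrm{prs}}_{N,k})P^{\mathrm{act},0}_k\|^{3/2}$, $P_k^{\mathrm{harm-tail}}:=\|(I-\Pi^{\mathrm{harm}}_{H,k})P^{\mathrm{harm},0}_k\|^{3/2}$, $P_k^{\mathrm{tail}}:=P_k^{\mathrm{comm}}+P_k^{\mathrm{trunc}}+P_k^{\mathrm{harm-tail}}$, $P_k^{\mathrm{low}}:=\|\Pi^{\mathrm{prs}}_{N,k}P^{\mathrm{act},0}_k\|^{3/2}+\|\Pi^{\mathrm{harm}}_{H,k}P^{\mathrm{harm},0}_k\|^{3/2}$, $P_k^{\mathrm{tail},+}:=P_k^{\mathrm{tail}}+P_k^{\mathrm{low}}$. Energy–flux costs: $A_k^{\mathrm{core}}:=\operatorname{ess\,sup}_{-\lambda^2<s<0}\int_{\lambda B_1}|u_k(y,s)|^2dy$, $E_k^{\mathrm{core}}:=\int_{-\lambda^2}^0\int_{\lambda B_1}|\nabla u_k|^2$, $L_k^{\mathrm{EF}}:=\int_{-\lambda^2}^0\int_{\lambda B_1}(|u_k|^2+|\nabla u_k|^2)+\int_{-\lambda^2}^0\int_{\lambda A_\chi}(|u_k|^3+|p_k||u_k|)$,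 $L_k^{\mathrm{AEF}}:=A_k^{\mathrm{core}}+L_k^{\mathrm{EF}}$. Residual: $R_k^{\mathrm{PFE}}$ is a finite sum of nine given nonnegative residuals $\Delta^{\mathrm{flux}}_{k,N},\Delta^{\mathrm{en}}_{k,N},\Delta^{\mathrm{src}}_{k,N,H},\Delta^{\mathrm{det}}_{k,N,H},\Delta^{\mathrm{chart}}_{k,N,H},\Delta^{\mathrm{gate}}_{k,N},\Delta^{\mathrm{rep}}_{k,N},\Delta^{\mathrm{res}}_{k,N},\Delta^{\mathrm{PFE,trunc}}_{k,N,H}$, none of which contains the full quantity $\Phi_k(\rho)$; $R_k^{\mathrm{PFE},+}:=R_k^{\mathrm{PFE}}$. Unamended detector ($D_k$ denotes the finite-rank data package of the scale-$k$ fields: finite-rank projections of velocity, pressure parts and $\eta u_k\otimes u_k$, finitely many flux and energy integrals, and finite-dimensional gate, observation and reproduction coordinates), with fixed weights $\beta_\bullet>0$: $M^{\mathrm{can}}_{k,N,H}(D_k):=\beta_{\mathrm{obs}}\mathrm{Obs}_k+\beta_{\mathrm{prs}}\mathrm{Tax}_{\mathrm{prs},k}+\beta_{\mathrm{harm}}\mathrm{Tax}_{\mathrm{harm},k}+\beta_{\mathrm{flux}}\mathrm{Tax}_{\mathrm{flux},k}+\beta_{\mathrm{en}}\mathrm{Tax}_{\mathrm{en},k}+\beta_{\mathrm{gate}}\mathrm{Tax}_{\mathrm{gate},k}+\beta_{\mathrm{rep}}\mathrm{Rep}_k+\beta_{\mathrm{res}}\mathrm{Res}_k$. All channels are nonnegative: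 $\mathrm{Tax}_{\mathrm{prs},k}=P_k^{\mathrm{comm}}+P_k^{\mathrm{trunc}}$; $\mathrm{Tax}_{\mathrm{harm},k}=P_k^{\mathrm{harm-tail}}$; $\mathrm{Tax}_{\mathrm{flux},k}$ is bounded by a fixed constant times $\int_{-\lambda^2}^0\int_{\lambda A_\chi}(|u_k|^3+|p_k||u_k|)$; $\mathrm{Tax}_{\mathrm{en},k}$ is bounded by a fixed constant times $\int_{Q_\lambda}(|u_k|^2+|\nabla u_k|^2)$; the summands of $R_k^{\mathrm{PFE}}$ are distributed among gate, reproduction and residual channels so that $\mathrm{Tax}_{\mathrm{gate},k}+\mathrm{Rep}_k+\mathrm{Res}_k=R_k^{\mathrm{PFE}}$; and $\mathrm{Obs}_k$ is at most a fixed constant $C_{\mathrm{obs},k}$ times the sum of the other seven channels. Amended detector, with fixed $\beta_A,\beta_E,\beta_{\mathrm{low}}>0$: $M^{\mathrm{can}+}_{k,N,H}(D_k):=M^{\mathrm{can}}_{k,N,H}(D_k)+\beta_AA_k^{\mathrm{core}}+\beta_EE_k^{\mathrm{core}}+\beta_{\mathrm{low}}P_k^{\mathrm{low}}$. Amended distance: $\delta^{\mathrm{can}+}_k:=A_k^{\mathrm{core}}+E_k^{\mathrm{core}}+P_k^{\mathrm{tail},+}+R_k^{\mathrm{PFE},+}$. *)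

(* Defs.v *)
From HB Require Import structures.
From mathcomp Require Import all_boot all_order all_algebra.
From mathcomp Require Import all_classical all_reals all_analysis.
From mathcomp Require Import ess_sup_inf.

Set Implicit Arguments.
Unset Strict Implicit.
Unset Printing Implicit Defensive.

Import Order.TTheory GRing.Theory Num.Theory.
Import numFieldNormedType.Exports.

Local Open Scope classical_set_scope.
Local Open Scope ring_scope.

(* [measurableTypeR R] is [R] with the Borel sigma-algebra on which
   [lebesgue_measure] is defined. *)
Notation space3 R :=
  (measurableTypeR R * measurableTypeR R * measurableTypeR R)%type.
Notation spacetime R := (space3 R * measurableTypeR R)%type.
Notation scalar_field R := (spacetime R -> R).
Notation vector_field R := ('I_3 -> spacetime R -> R).
Notation matrix_field R := ('I_3 -> 'I_3 -> spacetime R -> R).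

Notation leb1 R := (@lebesgue_measure R).
Notation leb3 R := (leb1 R \x leb1 R \x leb1 R)%E.
Notation leb4 R := (leb3 R \x leb1 R)%E.

Section Geometry.
Context {R : realType}.
Implicit Types (x y : space3 R) (r : R).

Definition coord3 x (i : 'I_3) : R :=
  match val i with 0%N => x.1.1 | 1%N => x.1.2 | _ => x.2 end.

Definition basis3 (i : 'I_3) : space3 R :=
  ((((i == 0%N :> nat)%:R : R), ((i == 1%N :> nat)%:R : R)),
   ((i == 2%N :> nat)%:R : R)).

Definition xdir (i : 'I_3) : spacetime R := (basis3 i, 0 : R).
Definition tdir : spacetime R := (0 : space3 R, 1 : R).

(* The norm carried by the product type is the sup norm, hence the
   explicit Euclidean one. *)
Definition vnorm (v : 'I_3 -> R) : R := Num.sqrt (\sum_i v i ^+ 2).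
Definition mnorm (A : 'I_3 -> 'I_3 -> R) : R :=
  Num.sqrt (\sum_i \sum_j A i j ^+ 2).

Definition eball x r : set (space3 R) := [set y | vnorm (coord3 (y - x)) < r].

Definition cylinder x (t : R) r : set (spacetime R) :=
  eball x r `*` `]t - r ^+ 2, t[.

Definition B r := eball 0 r.
Definition Q r := cylinder 0 0 r.

Definition leb1_on (a b : R) : {measure set (measurableTypeR R) -> \bar R} :=
  mrestr (leb1 R) (measurable_itv `]a, b[).

Definition past r : set (measurableTypeR R) := `]- r ^+ 2, 0[.

Definition dilate r (A : set (space3 R)) : set (space3 R) :=
  [set r *: y | y in A].

Definition at_point (u : vector_field R) (z : spacetime R) : 'I_3 -> R :=
  fun i => u i z.
Definition at_point2 (G : matrix_field R) (z : spacetime R) : 'I_3 -> 'I_3 -> R :=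
  fun i j => G i j z.

End Geometry.

Section Smooth.
Context {R : realType} {V : normedModType R}.

Definition iter_derive (vs : seq V) (f : V -> R) : V -> R :=
  foldr (fun v g => ('D_v g : V -> R)) f vs.

Definition smooth (f : V -> R) :=
  forall vs : seq V, continuous (iter_derive vs f) /\
    forall v x, derivable (iter_derive vs f) x v.

Definition tsupp (f : V -> R) : set V := closure [set x | f x != 0].

(* C_c^oo(O), as functions on the whole space *)
Definition test_function (O : set V) (f : V -> R) :=
  [/\ smooth f, compact (tsupp f) & tsupp f `<=` O].

End Smooth.

Definition cutoff {R : realType} (f : space3 R -> R) :=
  test_function (B 1) f /\ forall x, B (3 / 4) x -> f x = 1.

Section Lp.
Context {R : realType}.

Definition Lp_norm (p : R) (D : set (spacetime R)) (f : scalar_field R) : \bar R :=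
  ('N[leb4 R]_(p%:E)[EFin \o (f \_ D)])%E.

Definition in_Lp (p : R) (D : set (spacetime R)) (f : scalar_field R) :=
  measurable_fun D f /\ (Lp_norm p D f < +oo)%E.

Definition weak_gradient (D : set (spacetime R)) (u : vector_field R)
    (G : matrix_field R) :=
  forall i j,
    [/\ measurable_fun D (G i j),
        (forall C : set (spacetime R), compact C -> C `<=` D ->
           (leb4 R).-integrable C (EFin \o G i j)) &
        forall phi : scalar_field R, test_function D phi ->
          (\int[leb4 R]_(z in D) (u i z * 'D_(xdir j) phi z)%:E
           = - \int[leb4 R]_(z in D) (G i j z * phi z)%:E)%E].

(* A representative of the weak gradient; it is unique up to null sets, and is
   the junk value [0] when there is none. *)
Definition wgrad (D : set (spacetime R)) (u : vector_field R) : matrix_field R :=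
  xget (fun _ _ _ => 0) [set G | weak_gradient D u G].

End Lp.

Section NavierStokes.
Context {R : realType}.

(* Unit viscosity, no force. *)
Record suitable_weak_solution (x0 : space3 R) (t0 r : R)
    (u : vector_field R) (p : scalar_field R) : Prop := SuitableWeakSolution {
  sws_measurable : forall i, measurable_fun (cylinder x0 t0 r) (u i) ;
  sws_energy :
    (ess_sup (leb1_on (t0 - r ^+ 2)%R t0)
       (fun t => \int[leb3 R]_(x in eball x0 r)
                   (vnorm (at_point u (x, t)) ^+ 2)%:E) < +oo)%E ;
  sws_gradient : exists2 G, weak_gradient (cylinder x0 t0 r) u G &
    (\int[leb4 R]_(z in cylinder x0 t0 r)
       (mnorm (at_point2 G z) ^+ 2)%:E < +oo)%E ;
  sws_pressure : in_Lp (3 / 2) (cylinder x0 t0 r) p ;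
  sws_divergence_free : forall phi, test_function (cylinder x0 t0 r) phi ->
    (\int[leb4 R]_(z in cylinder x0 t0 r)
       (\sum_i u i z * 'D_(xdir i) phi z)%:E = 0)%E ;
  sws_momentum : forall phi : vector_field R,
    (forall i, test_function (cylinder x0 t0 r) (phi i)) ->
    (\int[leb4 R]_(z in cylinder x0 t0 r)
       (\sum_i (u i z * ('D_tdir (phi i) z
                         + \sum_j 'D_(xdir j) ('D_(xdir j) (phi i)) z)
                + \sum_j u i z * u j z * 'D_(xdir j) (phi i) z
                + p z * 'D_(xdir i) (phi i) z))%:E = 0)%E ;
  sws_local_energy : forall phi, test_function (cylinder x0 t0 r) phi ->
    (forall z, 0 <= phi z) ->
    (2%:E * \int[leb4 R]_(z in cylinder x0 t0 r)
        (mnorm (at_point2 (wgrad (cylinder x0 t0 r) u) z) ^+ 2 * phi z)%:E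
     <= \int[leb4 R]_(z in cylinder x0 t0 r)
        (vnorm (at_point u z) ^+ 2
           * ('D_tdir phi z + \sum_j 'D_(xdir j) ('D_(xdir j) phi) z)
         + (vnorm (at_point u z) ^+ 2 + 2 * p z)
           * \sum_i u i z * 'D_(xdir i) phi z)%:E)%E }.

Definition rescale (x0 : space3 R) (t0 r : R) (z : spacetime R) : spacetime R :=
  (x0 + r *: z.1, (t0 + r ^+ 2 * z.2 : R)).

Definition normalized_velocity (x0 : space3 R) (t0 r : R) (u : vector_field R) :
  vector_field R := fun i z => r * u i (rescale x0 t0 r z).

Definition normalized_pressure (x0 : space3 R) (t0 r : R) (p : scalar_field R) :
  scalar_field R := fun z => r ^+ 2 * p (rescale x0 t0 r z).

Definition mean (rho : R) (f : scalar_field R) (s : R) : R :=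
  (fine (leb3 R (B rho)))^-1 * \int[leb3 R]_(y in B rho) f (y, s).

Definition center (rho : R) (f : scalar_field R) : scalar_field R :=
  fun z => f z - mean rho f z.2.

Definition Phi (rho : R) (u : vector_field R) (p : scalar_field R) : \bar R :=
  ((rho ^- 2)%:E * \int[leb4 R]_(z in Q rho) (vnorm (at_point u z) ^+ 3)%:E
   + (rho ^- 2)%:E * \int[leb1 R]_(s in past rho)
       \int[leb3 R]_(y in B rho) (`|center rho p (y, s)| `^ (3 / 2))%:E)%E.

(* [eps] is a threshold for which epsilon-regularity holds: smallness of the
   CKN functional on [cylinder x0 t0 r] makes [(x0, t0)] a regular point. *)
Definition ckn_threshold (eps : R) :=
  0 < eps /\
  forall x0 t0 r u p, 0 < r -> suitable_weak_solution x0 t0 r u p ->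
    (Phi 1 (normalized_velocity x0 t0 r u) (normalized_pressure x0 t0 r p)
       < eps%:E)%E ->
    exists sigma C : R, [/\ 0 < sigma, sigma <= r &
      {ae leb4 R, forall z, cylinder x0 t0 sigma z -> vnorm (at_point u z) <= C}].

End NavierStokes.

Section Pressure.
Context {R : realType}.

(* Principal value of the kernel Gamma(2) / pi^2 * x_i / |x|^4, that is, the
   Fourier multiplier - sqrt(-1) xi_i / |xi|. *)
Definition riesz (i : 'I_3) (f : space3 R -> R) (x : space3 R) : R :=
  lim ((\int[leb3 R]_(y in ~` eball x e)
          (pi ^- 2 * coord3 (x - y) i / vnorm (coord3 (x - y)) ^+ 4 * f y))
       @[e --> 0^'+]).

(* [R_i R_j g] at each fixed time, after extension of [g] by zero outside the
   unit ball (the normalized fields live on [Q 1]). *)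
Definition rieszij (i j : 'I_3) (g : scalar_field R) : scalar_field R :=
  fun z => riesz i (riesz j ((fun y => g (y, z.2)) \_ (B 1))) z.1.

Definition P_act (eta : space3 R -> R) (u : vector_field R) : scalar_field R :=
  fun z => \sum_i \sum_j rieszij i j (fun z' => eta z'.1 * u i z' * u j z') z.

Definition P_harm eta u (p : scalar_field R) : scalar_field R :=
  fun z => p z - P_act eta u z.

Definition P_act0 rho eta u : scalar_field R := center rho (P_act eta u).
Definition P_harm0 rho eta u p : scalar_field R := center rho (P_harm eta u p).

Definition riesz_commutator (eta : space3 R -> R) (u : vector_field R) :
  scalar_field R := fun z =>
  \sum_i \sum_j (eta z.1 * rieszij i j (fun z' => u i z' * u j z') z
                 - rieszij i j (fun z' => eta z'.1 * (u i z' * u j z')) z).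

(* A projection of rank at most [n] on L^p(D; R^I), acting on representatives:
   all identities are up to null sets of [D]. *)
Definition finite_rank_projection (I : finType) (p : R) (D : set (spacetime R))
    (n : nat) (Pi : (I -> scalar_field R) -> (I -> scalar_field R)) :=
  let Lp f := forall i : I, in_Lp p D (f i) in
  let eqD f g := {ae leb4 R, forall z, D z -> forall i : I, f i z = g i z} in
  [/\ forall f, Lp f -> Lp (Pi f),
      forall (a : R) f g, Lp f -> Lp g ->
        eqD (Pi (fun i z => a * f i z + g i z))
            (fun i z => a * Pi f i z + Pi g i z),
      exists C : R, forall f, Lp f ->
        (\sum_i Lp_norm p D (Pi f i) <= C%:E * \sum_i Lp_norm p D (f i))%E,
      forall f, Lp f -> eqD (Pi (Pi f)) (Pi f) &
      exists b : 'I_n -> I -> scalar_field R,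
        (forall m, Lp (b m)) /\
        forall f, Lp f -> exists c : 'I_n -> R,
          eqD (Pi f) (fun i z => \sum_m c m * b m i z)].

Definition finite_rank_projection1 (p : R) (D : set (spacetime R)) (n : nat)
    (Pi : scalar_field R -> scalar_field R) :=
  finite_rank_projection p D n
    (fun (f : unit -> scalar_field R) (_ : unit) => Pi (f tt)).

(* || f ||_{L^{3/2}(Q rho)} ^ {3/2} *)
Definition cost32 (rho : R) (f : scalar_field R) : \bar R :=
  (Lp_norm (3 / 2)%R (Q rho) f `^ (3 / 2)%R)%E.

Definition residue (Pi : scalar_field R -> scalar_field R) (f : scalar_field R) :
  scalar_field R := fun z => f z - Pi f z.

Definition P_comm rho eta u : \bar R := cost32 rho (riesz_commutator eta u).

Definition P_trunc rho eta Pprs u : \bar R :=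
  cost32 rho (residue Pprs (P_act0 rho eta u)).

Definition P_harm_tail rho eta Pharm u p : \bar R :=
  cost32 rho (residue Pharm (P_harm0 rho eta u p)).

Definition P_tail rho eta Pprs Pharm u p : \bar R :=
  (P_comm rho eta u + P_trunc rho eta Pprs u + P_harm_tail rho eta Pharm u p)%E.

Definition P_low rho eta (Pprs Pharm : scalar_field R -> scalar_field R) u p :
  \bar R :=
  (cost32 rho (Pprs (P_act0 rho eta u))
   + cost32 rho (Pharm (P_harm0 rho eta u p)))%E.

Definition P_tail_plus rho eta Pprs Pharm u p : \bar R :=
  (P_tail rho eta Pprs Pharm u p + P_low rho eta Pprs Pharm u p)%E.

End Pressure.

Section EnergyFlux.
Context {R : realType} (lam : R) (chi : space3 R -> R).
Context (u : vector_field R) (p : scalar_field R).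

Definition A_chi : set (space3 R) :=
  closure [set y | exists i, 'D_(basis3 i) chi y != 0] `|`
  tsupp (fun y => \sum_i 'D_(basis3 i) ('D_(basis3 i) chi) y).

Definition A_core : \bar R :=
  ess_sup (leb1_on (- lam ^+ 2)%R 0%R)
    (fun s => (\int[leb3 R]_(y in dilate lam (B 1))
                 (vnorm (at_point u (y, s)) ^+ 2)%:E)%E).

Definition E_core : \bar R :=
  (\int[leb1 R]_(s in past lam) \int[leb3 R]_(y in dilate lam (B 1))
     (mnorm (at_point2 (wgrad (Q 1) u) (y, s)) ^+ 2)%:E)%E.

Definition flux_annulus : \bar R :=
  (\int[leb1 R]_(s in past lam) \int[leb3 R]_(y in dilate lam A_chi)
     (vnorm (at_point u (y, s)) ^+ 3
      + `|p (y, s)| * vnorm (at_point u (y, s)))%:E)%E.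

Definition L_EF : \bar R :=
  (\int[leb1 R]_(s in past lam) \int[leb3 R]_(y in dilate lam (B 1))
     (vnorm (at_point u (y, s)) ^+ 2
      + mnorm (at_point2 (wgrad (Q 1) u) (y, s)) ^+ 2)%:E
   + flux_annulus)%E.

Definition L_AEF : \bar R := (A_core + L_EF)%E.

Definition energy_Q : \bar R :=
  (\int[leb4 R]_(z in Q lam)
     (vnorm (at_point u z) ^+ 2
      + mnorm (at_point2 (wgrad (Q 1) u) z) ^+ 2)%:E)%E.

End EnergyFlux.

Record pfe_residuals (R : realType) (K : nat) := PFEResiduals {
  d_flux : 'I_K.+1 -> nat -> R ;
  d_en : 'I_K.+1 -> nat -> R ;
  d_src : 'I_K.+1 -> nat -> nat -> R ;
  d_det : 'I_K.+1 -> nat -> nat -> R ;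
  d_chart : 'I_K.+1 -> nat -> nat -> R ;
  d_gate : 'I_K.+1 -> nat -> R ;
  d_rep : 'I_K.+1 -> nat -> R ;
  d_res : 'I_K.+1 -> nat -> R ;
  d_trunc : 'I_K.+1 -> nat -> nat -> R }.

Section Residuals.
Context {R : realType} {K : nat} (d : pfe_residuals R K) (N H : nat).

Definition residuals_nonneg :=
  forall k : 'I_K.+1,
    [/\ 0 <= d_flux d k N, 0 <= d_en d k N, 0 <= d_src d k N H,
        0 <= d_det d k N H & 0 <= d_chart d k N H] /\
    [/\ 0 <= d_gate d k N, 0 <= d_rep d k N, 0 <= d_res d k N &
        0 <= d_trunc d k N H].

Definition R_PFE (k : 'I_K.+1) : R :=
  d_flux d k N + d_en d k N + d_src d k N H + d_det d k N H + d_chart d k N H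
  + d_gate d k N + d_rep d k N + d_res d k N + d_trunc d k N H.

Definition R_PFE_plus (k : 'I_K.+1) : R := R_PFE k.

End Residuals.

Section Detector.
Context {R : realType}.

Record package_dims := PackageDims {
  n_flux : nat ; n_en : nat ; n_gate : nat ; n_obs : nat ; n_rep : nat }.

Record data_package (dims : package_dims) := DataPackage {
  dp_velocity : vector_field R ;
  dp_act : scalar_field R ;
  dp_harm : scalar_field R ;
  dp_tensor : 'I_3 * 'I_3 -> scalar_field R ;
  dp_flux : 'rV[R]_(n_flux dims) ;
  dp_en : 'rV[R]_(n_en dims) ;
  dp_gate : 'rV[R]_(n_gate dims) ;
  dp_obs : 'rV[R]_(n_obs dims) ;
  dp_rep : 'rV[R]_(n_rep dims) }.

(* The choices, left open, through which a pair of fields is read: projections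
   of [u] and [eta u (x) u], densities of the flux and energy integrals (as
   functions of the point, u, grad u and p), and remaining coordinates. *)
Record readout (dims : package_dims) := Readout {
  ro_velocity : vector_field R -> vector_field R ;
  ro_tensor :
    ('I_3 * 'I_3 -> scalar_field R) -> ('I_3 * 'I_3 -> scalar_field R) ;
  ro_flux : 'I_(n_flux dims) ->
    spacetime R -> ('I_3 -> R) -> ('I_3 -> 'I_3 -> R) -> R -> R ;
  ro_en : 'I_(n_en dims) ->
    spacetime R -> ('I_3 -> R) -> ('I_3 -> 'I_3 -> R) -> R -> R ;
  ro_gate : vector_field R -> scalar_field R -> 'rV[R]_(n_gate dims) ;
  ro_obs : vector_field R -> scalar_field R -> 'rV[R]_(n_obs dims) ;
  ro_rep : vector_field R -> scalar_field R -> 'rV[R]_(n_rep dims) }.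

Definition readout_finite_rank (dims : package_dims) (rho : R) (ro : readout dims) :=
  (exists n, finite_rank_projection 3 (Q rho) n (ro_velocity ro)) /\
  (exists n, finite_rank_projection (3 / 2) (Q rho) n (ro_tensor ro)).

Definition package (dims : package_dims) (ro : readout dims) rho
    (eta : space3 R -> R) (Pprs Pharm : scalar_field R -> scalar_field R)
    (u : vector_field R) (p : scalar_field R) : data_package dims :=
  let integral_of F := \int[leb4 R]_(z in Q 1)
    F z (at_point u z) (at_point2 (wgrad (Q 1) u) z) (p z) in
  {| dp_velocity := ro_velocity ro u ;
     dp_act := Pprs (P_act0 rho eta u) ;
     dp_harm := Pharm (P_harm0 rho eta u p) ;
     dp_tensor := ro_tensor ro (fun ij z => eta z.1 * u ij.1 z * u ij.2 z) ;
     dp_flux := \row_m integral_of (ro_flux ro m) ;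
     dp_en := \row_m integral_of (ro_en ro m) ;
     dp_gate := ro_gate ro u p ;
     dp_obs := ro_obs ro u p ;
     dp_rep := ro_rep ro u p |}.

Record channels (dims : package_dims) := Channels {
  Obs : data_package dims -> \bar R ;
  Tax_prs : data_package dims -> \bar R ;
  Tax_harm : data_package dims -> \bar R ;
  Tax_flux : data_package dims -> \bar R ;
  Tax_en : data_package dims -> \bar R ;
  Tax_gate : data_package dims -> \bar R ;
  Rep : data_package dims -> \bar R ;
  Res : data_package dims -> \bar R }.

Record weights := Weights {
  b_obs : R ; b_prs : R ; b_harm : R ; b_flux : R ;
  b_en : R ; b_gate : R ; b_rep : R ; b_res : R }.

Definition weights_pos (b : weights) :=
  [/\ 0 < b_obs b, 0 < b_prs b, 0 < b_harm b & 0 < b_flux b] /\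
  [/\ 0 < b_en b, 0 < b_gate b, 0 < b_rep b & 0 < b_res b].

Definition channels_nonneg dims (c : channels dims) (D : data_package dims) :=
  ([/\ 0 <= Obs c D, 0 <= Tax_prs c D, 0 <= Tax_harm c D & 0 <= Tax_flux c D] /\
   [/\ 0 <= Tax_en c D, 0 <= Tax_gate c D, 0 <= Rep c D & 0 <= Res c D])%E.

Definition M_can (b : weights) dims (c : channels dims) (D : data_package dims) :
  \bar R :=
  ((b_obs b)%:E * Obs c D + (b_prs b)%:E * Tax_prs c D
   + (b_harm b)%:E * Tax_harm c D + (b_flux b)%:E * Tax_flux c D
   + (b_en b)%:E * Tax_en c D + (b_gate b)%:E * Tax_gate c D
   + (b_rep b)%:E * Rep c D + (b_res b)%:E * Res c D)%E.

End Detector.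

(* Main.v *)
(* On a bad scale the lower bound and the gap give
   [C_k * X_k >= M_k >= c_k * dist_k >= (min c) * delta_star], where
   [X_k = L_k^AEF + P_k^{tail,+} + R_k^{PFE,+}]; on any other scale
   [C_k * X_k >= M_k >= 0].  Dividing by [(min c) * delta_star], weighting by
   [w_k] and summing is all that remains, once [X_k] and [dist_k] are known to be
   nonnegative, possibly infinite, extended reals. *)
Require Import Defs.
From HB Require Import structures.
From mathcomp Require Import all_boot all_order all_algebra.
From mathcomp Require Import all_classical all_reals all_analysis.
From mathcomp Require Import ess_sup_inf.

Set Implicit Arguments.
Unset Strict Implicit.
Unset Printing Implicit Defensive.

Import Order.TTheory GRing.Theory Num.Theory.
Import numFieldNormedType.Exports.

Local Open Scope classical_set_scope.
Local Open Scope ring_scope.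

(* No sign is assumed on [Cup]: where it is negative, [Cup k * X k >= 0] forces
   [X k = 0], and likewise for the maximum. *)
Lemma weighted_bad_scales (R : realType) (K : nat) (w Cup c : 'I_K.+1 -> R)
    (ds : R) (M X dist : 'I_K.+1 -> \bar R) (bad : {set 'I_K.+1}) :
  (forall k, 0 <= w k) -> (forall k, 0 < c k) -> 0 < ds ->
  (forall k, 0 <= X k)%E -> (forall k, 0 <= dist k)%E ->
  (forall k, M k <= (Cup k)%:E * X k)%E ->
  (forall k, (c k)%:E * dist k <= M k)%E ->
  (forall k, k \in bad -> ds%:E <= dist k)%E ->
  ((\sum_(k in bad) w k)%:E
     <= (\big[Num.max/Cup ord0]_(k < K.+1) Cup k
          / ((\big[Num.min/c ord0]_(k < K.+1) c k) * ds))%:E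
        * \sum_(k < K.+1) (w k)%:E * X k)%E.
Proof.
move=> w0 c0 ds0 X0 dist0 upper lower gap.
set Cmax := (X in X / _); set cmin := (X in X * ds).
(* The seed [c ord0] is itself a value of [c], so [cmin] is the true minimum of a nonempty finite
   family and inherits its positivity. *)
have cmin_gt0 : 0 < cmin by rewrite /cmin; elim/big_ind: _ => // a b a0 b0; rewrite lt_min a0.
have cmin_le k : cmin <= c k by exact: bigmin_le.
have Cmax_ge k : Cup k <= Cmax by exact: le_bigmax.
(* This chain holds on every scale, bad or not. Replacing [c k] by [cmin] uses [0 <= dist k], and
   replacing [Cup k] by [Cmax] uses [0 <= X k]. *)
have scale k : ((cmin%:E * dist k) <= Cmax%:E * X k)%E.
  apply: (@le_trans _ _ ((c k)%:E * dist k)%E); first by rewrite lee_wpmul2r// lee_fin.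
  apply: (le_trans (lower k)); apply: (le_trans (upper k)).
  by rewrite lee_wpmul2r// lee_fin.
have den_gt0 : 0 < cmin * ds by rewrite mulr_gt0.
(* Extending the weights by zero off [bad] makes both sides sums over all scales, so it suffices to
   compare them term by term. *)
pose m k : R := if k \in bad then w k else 0.
have term k : ((m k)%:E <= (Cmax / (cmin * ds))%:E * ((w k)%:E * X k))%E.
  (* The factors are regrouped so that [scale] gets multiplied by [w k / (cmin * ds)], which is
     nonnegative whatever the sign of [Cmax]. *)
  have -> : ((Cmax / (cmin * ds))%:E * ((w k)%:E * X k) =
             (w k / (cmin * ds))%:E * (Cmax%:E * X k))%E.
    by rewrite !muleA -!EFinM; congr ((_)%:E * _)%E; rewrite mulrAC [RHS]mulrAC (mulrC (w k)).
  have wd0 : 0 <= w k / (cmin * ds) by rewrite divr_ge0// ltW.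
  apply: (@le_trans _ _ ((w k / (cmin * ds))%:E * (cmin%:E * dist k))%E); last first.
    by rewrite lee_wpmul2l.
  (* Off [bad] the left side is zero. On [bad] the gap replaces [dist k] by [ds], and the
     denominator [cmin * ds] cancels exactly, leaving [w k]. *)
  rewrite /m; case: ifPn => [kb|_]; last by rewrite !mule_ge0// lee_fin ltW.
  apply: (@le_trans _ _ ((w k / (cmin * ds))%:E * (cmin%:E * ds%:E))%E).
    by rewrite -!EFinM lee_fin divfK// gt_eqF.
  by rewrite !lee_wpmul2l ?gap// lee_fin ltW.
have sumE : (\sum_(k in bad) w k)%:E = (\sum_k (m k)%:E)%E.
  by rewrite sumEFin big_mkcond.
(* Distributivity over a sum of extended reals is safe here because all the terms [w k * X k] are
   nonnegative. *)
rewrite sumE ge0_sume_distrr; last by move=> k _; rewrite mule_ge0 ?lee_fin.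
exact: lee_sum.
Qed.

Lemma P_tail_plus_ge0 (R : realType) (rho : R) eta Pprs Pharm u p :
  (0 <= P_tail_plus rho eta Pprs Pharm u p)%E.
Proof. by rewrite !adde_ge0// poweR_ge0. Qed.

(** For the zero measure the essential supremum would be [-oo], even of a nonnegative function. With
    [0 < lam] the time interval has positive length [lam ^+ 2], which excludes this. *)
Lemma A_core_ge0 (R : realType) (lam : R) (u : vector_field R) :
  0 < lam -> (0 <= A_core lam u)%E.
Proof.
move=> lam0; apply: ess_sup_gee.
  have -> : leb1_on (- lam ^+ 2) 0 [set: measurableTypeR R] = leb1 R `]- lam ^+ 2, 0[%classic.
    by rewrite -[RHS](congr1 (leb1 R) (setTI _)).
  rewrite lebesgue_measure_itv/= lte_fin oppr_lt0 exprn_gt0//.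
  by rewrite -EFinB sub0r opprK lte_fin exprn_gt0.
apply: nearW => s; apply: integral_ge0 => y _.
by rewrite lee_fin sqr_ge0.
Qed.

Lemma E_core_ge0 (R : realType) (lam : R) (u : vector_field R) :
  (0 <= E_core lam u)%E.
Proof.
by apply: integral_ge0 => s _; apply: integral_ge0 => y _; rewrite lee_fin sqr_ge0.
Qed.

Lemma L_EF_ge0 (R : realType) (lam : R) chi (u : vector_field R) p :
  (0 <= L_EF lam chi u p)%E.
Proof.
apply: adde_ge0; apply: integral_ge0 => s _; apply: integral_ge0 => y _;
  rewrite lee_fin addr_ge0 ?sqr_ge0// ?exprn_ge0 ?mulr_ge0 ?sqrtr_ge0//.
Qed.

Lemma R_PFE_plus_ge0 (R : realType) (K N H : nat) (d : pfe_residuals R K) k :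
  residuals_nonneg d N H -> 0 <= R_PFE_plus d N H k.
Proof. by move=> /(_ k)[[? ? ? ? ?] [? ? ? ?]]; rewrite !addr_ge0. Qed.

Theorem theorem8p15 (R : realType)
  (x0 : space3 R) (t0 r0 : R) (u : vector_field R) (p : scalar_field R)
  (rho lam : R) (K N H : nat) (eps : R)
  (eta chi : space3 R -> R)
  (Pprs Pharm : 'I_K.+1 -> scalar_field R -> scalar_field R)
  (delta : pfe_residuals R K)
  (dims : package_dims) (ro : 'I_K.+1 -> @readout R dims)
  (ch : 'I_K.+1 -> @channels R dims)
  (beta : @weights R) (betaA betaE betalow : R)
  (Cflux Cen : R) (Cobs : 'I_K.+1 -> R)
  (w Cup c : 'I_K.+1 -> R) (delta_star : R) :
  let r (k : 'I_K.+1) := lam ^+ k * r0 in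
  let uk k := normalized_velocity x0 t0 (r k) u in
  let pk k := normalized_pressure x0 t0 (r k) p in
  let Phik k := Phi rho (uk k) (pk k) in
  let Acore k := A_core lam (uk k) in
  let Ecore k := E_core lam (uk k) in
  let LAEF k := L_AEF lam chi (uk k) (pk k) in
  let Plow k := P_low rho eta (Pprs k) (Pharm k) (uk k) (pk k) in
  let Ptail k := P_tail_plus rho eta (Pprs k) (Pharm k) (uk k) (pk k) in
  let RPFE k := (R_PFE_plus delta N H k)%:E in
  let D k := package (ro k) rho eta (Pprs k) (Pharm k) (uk k) (pk k) in
  let M k := (M_can beta (ch k) (D k) + betaA%:E * Acore k
              + betaE%:E * Ecore k + betalow%:E * Plow k)%E in
  let dist k := (Acore k + Ecore k + Ptail k + RPFE k)%E in
  let Bcan := [set k | (eps%:E <= Phik k)%E]%SET in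
  let Ccan := \big[Num.max/Cup ord0]_(k < K.+1) Cup k
              / ((\big[Num.min/c ord0]_(k < K.+1) c k) * delta_star) in
  0 < r0 -> suitable_weak_solution x0 t0 r0 u p ->
  0 < rho -> rho <= lam -> lam < 3 / 4 ->
  ckn_threshold eps ->
  cutoff eta -> cutoff chi ->
  (forall k, finite_rank_projection1 (3 / 2) (Q rho) N (Pprs k)) ->
  (forall k, finite_rank_projection1 (3 / 2) (Q rho) H (Pharm k)) ->
  residuals_nonneg delta N H ->
  (forall k, readout_finite_rank rho (ro k)) ->
  weights_pos beta -> 0 < betaA -> 0 < betaE -> 0 < betalow ->
  (forall k, channels_nonneg (ch k) (D k)) ->
  (forall k, Tax_prs (ch k) (D k)
     = P_comm rho eta (uk k) + P_trunc rho eta (Pprs k) (uk k))%E ->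
  (forall k, Tax_harm (ch k) (D k)
     = P_harm_tail rho eta (Pharm k) (uk k) (pk k)) ->
  (forall k, Tax_flux (ch k) (D k)
     <= Cflux%:E * flux_annulus lam chi (uk k) (pk k))%E ->
  (forall k, Tax_en (ch k) (D k) <= Cen%:E * energy_Q lam (uk k))%E ->
  (forall k, Tax_gate (ch k) (D k) + Rep (ch k) (D k) + Res (ch k) (D k)
     = (R_PFE delta N H k)%:E)%E ->
  (forall k, Obs (ch k) (D k)
     <= (Cobs k)%:E * (Tax_prs (ch k) (D k) + Tax_harm (ch k) (D k)
          + Tax_flux (ch k) (D k) + Tax_en (ch k) (D k)
          + Tax_gate (ch k) (D k) + Rep (ch k) (D k) + Res (ch k) (D k)))%E ->
  (forall k, 0 <= w k) ->
  (forall k, 0 < c k) -> 0 < delta_star ->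
  (forall k, M k <= (Cup k)%:E * (LAEF k + Ptail k + RPFE k))%E ->
  (forall k, (c k)%:E * dist k <= M k)%E ->
  (forall k, eps%:E <= Phik k -> delta_star%:E <= dist k)%E ->
  ((\sum_(k in Bcan) w k)%:E
     <= Ccan%:E * \sum_(k < K.+1) (w k)%:E * (LAEF k + Ptail k + RPFE k))%E.
Proof.
move=> r uk pk Phik Acore Ecore LAEF Plow Ptail RPFE D M dist Bcan Ccan _ _ rho0
  rho_lam _ _ _ _ _ _ res0 _ _ _ _ _ _ _ _ _ _ _ _ w0 c0 ds0 upper lower gap.
(* Positivity of [lam] is inherited from [rho]; it is what [A_core_ge0] asks for. *)
have lam0 : 0 < lam by exact: lt_le_trans rho_lam.
have A0 k : (0 <= Acore k)%E by exact: A_core_ge0.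
have E0 k : (0 <= Ecore k)%E by exact: E_core_ge0.
have P0 k : (0 <= Ptail k)%E by exact: P_tail_plus_ge0.
have R0 k : (0 <= RPFE k)%E by rewrite lee_fin R_PFE_plus_ge0.
have L0 k : (0 <= LAEF k)%E by apply: adde_ge0; [exact: A0|exact: L_EF_ge0].
(* What remains is nonnegativity of the total cost and of the distance, each sum being split into
   its summands, and the gap with membership in [Bcan] unfolded. *)
apply: (@weighted_bad_scales _ _ _ _ _ _ M _ dist) => // k.
- by apply: adde_ge0 => //; apply: adde_ge0.
- by do 3!apply: adde_ge0 => //.
- by rewrite inE; exact: gap.
Qed.
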